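(* Let $n\ge1$, let $C(\partial)=\begin{pmatrix} 0 & \partial \\ I_{n-1} & 0 \end{pmatrix}\in\mathbb{C}[\partial]^{n\times n}$, where $I_{n-1}$ is the $(n-1)\times(n-1)$ identity matrix, and let $a,b\in\mathbb{C}$ with $a\neq0$. Then the generalized conformal module $V_{a,b,C(\partial)}$ over $Vir$ is irreducible.
   Context: The matrix $C(\partial)$ has $(1,n)$-entry $\partial$, entries $(i+1,i)$ equal to $1$ for $1\le i\le n-1$, and all other entries $0$. The Virasoro conformal algebra is $Vir=\mathbb{C}[\partial]L$ with $[L_\lambda L]=(\partial+2\lambda)L$. A generalized conformal module $V$ over $Vir$ is a $\mathbb{C}[\partial]$-module with a linear map $L_\lambda:V\to V[[\lambda]]$ such that $L_\lambda(\partial v)=(\partial+\lambda)L_\lambda v$ and $L_\lambda(L_\mu v)-L_\mu(L_\lambda v)=(\lambda-\mu)L_{\lambda+\mu}v$ for all $v\in V$. A submodule is a $\mathbb{C}[\partial]$-submodule $W$ with $L_\lambda W\subseteq W[[\lambda]]$; $V$ is irreducible if $V\ne0$ and its only submodules are $0$ and $V$. For $a,b\in\mathbb{C}$ and $C(\partial)\in\mathbb{C}[\partial]^{n\times n}$, $V_{a,b,C(\partial)}$ is the free $\mathbb{C}[\partial]$-module $\mathbb{C}[\partial]^n$ with the action $$L_\lambda\mathbf{f}(\partial)=(\partial+a\lambda+b)e^{\lambda\mathcal{L}}\mathbf{f}(\partial)=\sum_{k\ge0}\frac{\lambda^k}{k!}\big((\partial+b)\mathcal{L}^k+ka\mathcal{L}^{k-1}\big)\mathbf{f}(\partial),$$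 where $\mathcal{L}=\frac{d}{d\partial}+C(\partial)$ acts on column vectors by $\mathcal{L}\mathbf{f}=\mathbf{f}'+C(\partial)\mathbf{f}$. This is a generalized conformal module over $Vir$. *)

(* Defs.v *)
From HB Require Import structures.
From mathcomp Require Import all_boot all_order all_algebra.
From mathcomp Require Import boolp classical_sets reals complex ring.

Set Implicit Arguments.
Unset Strict Implicit.
Unset Printing Implicit Defensive.

Import Order.TTheory GRing.Theory Num.Theory.
Local Open Scope ring_scope.

(* Formal power series with coefficients in a module V are represented by
   their coefficients: g : nat -> V stands for \sum_k g k lambda^k, and
   h : nat -> nat -> V for \sum_(i, j) h i j lambda^i mu^j.
   The ring C[d] is {poly K}, with 'X for d. *)
Section PowerSeries.
Variable V : zmodType.

Definition mulvar (g : nat -> V) (k : nat) : V :=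
  if k is k'.+1 then g k' else 0.

Definition mul_lambda (h : nat -> nat -> V) (i j : nat) : V :=
  mulvar (fun i' => h i' j) i.

Definition mul_mu (h : nat -> nat -> V) (i j : nat) : V := mulvar (h i) j.

(* g(lambda + mu): the coefficient of lambda^i mu^j in
   \sum_k g k (lambda + mu)^k. *)
Definition subst_add (g : nat -> V) (i j : nat) : V := g (i + j)%N *+ 'C(i + j, i).

End PowerSeries.

(* [vir_act v k] is the coefficient of lambda^k in L_lambda v. *)
Record vir_module (K : fieldType) := VirModule {
  vir_sort :> lmodType {poly K};
  vir_act : vir_sort -> nat -> vir_sort;
  vir_act_linear : forall (c : K) (u v : vir_sort) (k : nat),
    vir_act (c%:P *: u + v) k = c%:P *: vir_act u k + vir_act v k;
  vir_act_deriv : forall (v : vir_sort) (k : nat),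
    vir_act ('X *: v) k = 'X *: vir_act v k + mulvar (vir_act v) k;
  vir_act_jacobi : forall (v : vir_sort) (i j : nat),
    vir_act (vir_act v j) i - vir_act (vir_act v i) j =
      mul_lambda (subst_add (vir_act v)) i j
      - mul_mu (subst_add (vir_act v)) i j
}.

Definition vir_submodule (K : fieldType) (V : vir_module K) (W : set V) : Prop :=
  [/\ W 0,
      forall (p : {poly K}) (u v : V), W u -> W v -> W (p *: u + v) &
      forall (v : V) (k : nat), W v -> W (vir_act v k)].

Definition vir_irreducible (K : fieldType) (V : vir_module K) : Prop :=
  (exists v : V, v <> 0) /\
  forall W : set V, vir_submodule W -> W = [set 0]%classic \/ W = setT.

Section Vabc.
Variables (K : numFieldType) (n : nat) (a b : K) (C : 'M[{poly K}]_n).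
Implicit Types (f g : 'cV[{poly K}]_n) (c : K).

Definition calL f : 'cV[{poly K}]_n := map_mx (@deriv K) f + C *m f.

(* e^{lambda calL} f *)
Definition exp_calL f (k : nat) : 'cV[{poly K}]_n :=
  (k`!%:R^-1)%:P *: iter k calL f.

(* (d + a lambda + b) e^{lambda calL} f *)
Definition Vabc_act f (k : nat) : 'cV[{poly K}]_n :=
  ('X + b%:P) *: exp_calL f k + a%:P *: mulvar (exp_calL f) k.

Lemma Vabc_actE f k :
  Vabc_act f k = (k`!%:R^-1)%:P *:
    (('X + b%:P) *: iter k calL f + (k%:R * a)%:P *: iter k.-1 calL f).
Proof.
rewrite /Vabc_act /exp_calL scalerDr !scalerA [in RHS]mulrC; congr (_ + _).
case: k => [|k] /=; first by rewrite mul0r mulr0 scale0r scaler0.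
rewrite scalerA -!polyCM; congr (_%:P *: _).
have Hk : k`!%:R != 0 :> K by rewrite pnatr_eq0 -lt0n fact_gt0.
have Hk1 : k.+1%:R != 0 :> K by rewrite pnatr_eq0.
by rewrite factS natrM; field; rewrite Hk nat1r.
Qed.

Lemma calL_linear c f g : calL (c%:P *: f + g) = c%:P *: calL f + calL g.
Proof.
rewrite /calL mulmxDr -scalemxAr; apply/matrixP => i j.
rewrite !mxE derivD derivM derivC.
by ring.
Qed.

Lemma calLX f : calL ('X *: f) = 'X *: calL f + f.
Proof.
rewrite /calL -scalemxAr; apply/matrixP => i j.
by rewrite !mxE derivM derivX; ring.
Qed.

Lemma iter_calL_linear k c f g :
  iter k calL (c%:P *: f + g) = c%:P *: iter k calL f + iter k calL g.
Proof. by elim: k => //= k ->; rewrite calL_linear. Qed.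

Lemma iter_calLX k f :
  iter k calL ('X *: f) = 'X *: iter k calL f + k%:R%:P *: iter k.-1 calL f.
Proof.
elim: k => [|k IH] /=; first by rewrite scale0r addr0.
rewrite IH addrC calL_linear calLX addrC -addrA; congr (_ + _).
case: k {IH} => [|k] /=; first by rewrite scale0r scale1r addr0.
by rewrite -[k.+2]addn1 natrD polyCD scalerDl scale1r addrC.
Qed.

Lemma exp_calL_linear k c f g :
  exp_calL (c%:P *: f + g) k = c%:P *: exp_calL f k + exp_calL g k.
Proof. by rewrite /exp_calL iter_calL_linear scalerDr !scalerA mulrC. Qed.

Lemma exp_calLX k f :
  exp_calL ('X *: f) k = 'X *: exp_calL f k + mulvar (exp_calL f) k.
Proof.
rewrite /exp_calL iter_calLX scalerDr !scalerA mulrC; congr (_ + _).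
case: k => [|k] /=; first by rewrite mulr0 scale0r.
rewrite -polyCM factS natrM invfM mulrAC mulVf ?mul1r //.
by rewrite pnatr_eq0.
Qed.

Lemma exp_calL_comp i j f :
  exp_calL (exp_calL f j) i = exp_calL f (i + j) *+ 'C(i + j, i).
Proof.
rewrite /exp_calL.
have := iter_calL_linear i (j`!%:R^-1) (iter j calL f) 0.
have iter0 m : iter m calL 0 = 0.
  elim: m => //= m ->; have := calL_linear (-1) 0 0.
  by rewrite scaler0 addr0 polyCN polyC1 scaleN1r addNr.
rewrite iter0 !addr0 => ->; rewrite -iterD scalerA -scaler_nat scalerA.
rewrite -(polyC_natr _ (binomial _ _)) -!polyCM; congr (_%:P *: _).
have Hi : i`!%:R != 0 :> K by rewrite pnatr_eq0 -lt0n fact_gt0.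
have Hj : j`!%:R != 0 :> K by rewrite pnatr_eq0 -lt0n fact_gt0.
have Hb : 'C(i + j, i)%:R != 0 :> K.
  by rewrite pnatr_eq0 -lt0n bin_gt0 leq_addr.
have /(congr1 (fun m => m%:R : K)) := bin_fact (leq_addr j i).
rewrite addKn !natrM => <-.
by field; rewrite Hi Hj Hb.
Qed.

Lemma Vabc_act_linear c f g k :
  Vabc_act (c%:P *: f + g) k = c%:P *: Vabc_act f k + Vabc_act g k.
Proof.
rewrite /Vabc_act exp_calL_linear.
have -> : mulvar (exp_calL (c%:P *: f + g)) k =
    c%:P *: mulvar (exp_calL f) k + mulvar (exp_calL g) k.
  by case: k => [|k] /=; rewrite ?scaler0 ?addr0 // exp_calL_linear.
by apply/matrixP => i j; rewrite !mxE; ring.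
Qed.

Lemma Vabc_actX f k :
  Vabc_act ('X *: f) k = 'X *: Vabc_act f k + mulvar (Vabc_act f) k.
Proof.
rewrite /Vabc_act; case: k => [|k] /=; rewrite !exp_calLX /=.
  by apply/matrixP => i j; rewrite !mxE; ring.
by apply/matrixP => i j; rewrite !mxE; ring.
Qed.

Lemma Vabc_act_comp f i j (P := fun i j => exp_calL (exp_calL f j) i) :
  Vabc_act (Vabc_act f j) i =
    ('X + b%:P) *: (('X + b%:P) *: P i j + mul_lambda P i j)
    + a%:P *: (('X + b%:P) *: (mul_lambda P i j + mul_mu P i j)
       + mul_lambda (mul_lambda P) i j)
    + (a * a)%:P *: mul_lambda (mul_mu P) i j.
Proof.
have exp0 m : exp_calL 0 m = 0.
  have := exp_calL_linear m (-1) 0 0.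
  by rewrite scaler0 addr0 polyCN polyC1 scaleN1r addNr.
have E m : exp_calL (Vabc_act f j) m =
    ('X + b%:P) *: P m j + mul_lambda P m j + a%:P *: mul_mu P m j.
  rewrite /Vabc_act scalerDl -addrA -[X in exp_calL X]addrC -addrA.
  rewrite exp_calL_linear -[a%:P *: _ + _]addrC.
  rewrite [X in X + _](_ : _ = b%:P *: P m j) //.
  rewrite addrC exp_calL_linear exp_calLX.
  rewrite [exp_calL (mulvar _ j) m](_ : _ = mul_mu P m j); last first.
    by rewrite /mul_mu; case: (j) => //=; rewrite exp0.
  rewrite [mulvar _ m](_ : _ = mul_lambda P m j); last by case: m.
  by apply/matrixP => k l; rewrite !mxE; ring.
rewrite {1}/Vabc_act E.
rewrite [mulvar _ i](_ : _ = ('X + b%:P) *: mul_lambda P i j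
   + mul_lambda (mul_lambda P) i j + a%:P *: mul_lambda (mul_mu P) i j).
  by apply/matrixP => k l; rewrite !mxE polyCM; ring.
by case: i => [|i] /=; rewrite ?E // /mul_lambda /= !scaler0 !addr0.
Qed.

Lemma Vabc_act_jacobi f i j :
  Vabc_act (Vabc_act f j) i - Vabc_act (Vabc_act f i) j =
    mul_lambda (subst_add (Vabc_act f)) i j
    - mul_mu (subst_add (Vabc_act f)) i j.
Proof.
pose P i j := exp_calL (exp_calL f j) i.
rewrite !Vabc_act_comp -!/P -[exp_calL (exp_calL f j) i]/(P i j) -[exp_calL (exp_calL f i) j]/(P j i).
have PC k l : P k l = P l k.
  by rewrite /P !exp_calL_comp addnC -{1}bin_sub ?leq_addl // addnK.
have T k l : subst_add (Vabc_act f) k l =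
    ('X + b%:P) *: P k l + a%:P *: (mul_lambda P k l + mul_mu P k l).
  rewrite /subst_add /Vabc_act mulrnDl (scalerMnr (_ + _)) (scalerMnr a%:P).
  congr (_ *: _ + _ *: _).
    by rewrite /P exp_calL_comp.
  rewrite /mul_lambda /mul_mu /P; case: k => [|k]; case: l => [|l] /=.
  - by rewrite mul0rn addr0.
  - by rewrite exp_calL_comp !add0n !bin0 add0r.
  - by rewrite exp_calL_comp !addn0 !binn addr0.
  - by rewrite !exp_calL_comp addSn binS mulrnDr addnS addSn addrC.
have sw k l : mul_lambda P k l = mul_mu P l k.
  by rewrite /mul_lambda /mul_mu; case: k => //= k.
have TL : mul_lambda (subst_add (Vabc_act f)) i j =
    ('X + b%:P) *: mul_lambda P i j
    + a%:P *: (mul_lambda (mul_lambda P) i j + mul_lambda (mul_mu P) i j).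
  rewrite {1}/mul_lambda; case: (i) => [|k] /=; last by rewrite T.
  by rewrite /mul_lambda /= !addr0 !scaler0 addr0.
have TM : mul_mu (subst_add (Vabc_act f)) i j =
    ('X + b%:P) *: mul_mu P i j
    + a%:P *: (mul_lambda (mul_mu P) i j + mul_lambda (mul_lambda P) j i).
  rewrite {1}/mul_mu; case: (j) => [|l] /=.
    by rewrite /mul_lambda /mul_mu /=; case: (i) => [|k] /=; rewrite !addr0 !scaler0 addr0.
  rewrite T; congr (_ + _ *: (_ + _)).
  by rewrite /mul_lambda /= -/(mul_lambda P l i) sw.
have S2 : mul_lambda (mul_mu P) j i = mul_lambda (mul_mu P) i j.
  rewrite /mul_lambda /mul_mu; case: (i) => [|k]; case: (j) => [|l] //=.
have S3 : mul_lambda P j i = mul_mu P i j by rewrite sw.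
have S4 : mul_mu P j i = mul_lambda P i j by rewrite sw.
rewrite TL TM S2 S3 S4 (PC j i).
by apply/matrixP => k l; rewrite !mxE; ring.
Qed.

Definition Vabc : vir_module K :=
  VirModule Vabc_act_linear Vabc_actX Vabc_act_jacobi.

End Vabc.

(* For n = 1 this is the 1 x 1 matrix ('X). *)
Definition Cmat (K : fieldType) (n : nat) : 'M[{poly K}]_n :=
  \matrix_(i, j)
    if (i == 0 :> nat) && (j.+1 == n) then 'X
    else (i == j.+1 :> nat)%:R.

(* Main.v *)
(* Write d for 'X, s = d + b and calL = D for d/dd + C. Up to a nonzero scalar,
   the coefficient of lambda^k in the action is A_k = s D^k + k a D^(k-1). Let W be
   a nonzero submodule of V, and I the ideal of the p such that p V is contained
   in W.
   - I is nonzero. Identify V with C[x], with d = x^n, so that C becomes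
     multiplication by x. Then A_k raises the degree in x by n + k, so for nonzero
     f in W the degrees of A_0 f, ..., A_(n-1) f are distinct modulo n; hence
     these vectors are independent over C[d], and their determinant lies in I.
   - If p in I then s p' in I, because [A_1, p] = s p'. A nonzero p in I of least
     degree m thus satisfies s p' = m p, so that p is a multiple of s^m.
   - If s^(m+1) is in I, then s^m A_(m+2) s^(m+1) v = (m+2) a (m+1)! s^m v modulo
     s^(m+1) V, so s^m is in I, as a is nonzero. Descending, 1 is in I. *)
Require Import Defs.
From mathcomp Require Import all_boot all_order all_algebra.
From mathcomp Require Import boolp classical_sets reals complex ring zify.
Import GRing.Theory.
Local Open Scope ring_scope.
Local Open Scope complex_scope.

(** * Polynomials in one variable *)

Section PolyFacts.
Set Implicit Arguments.
Unset Strict Implicit.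
Variable K : numFieldType.
Implicit Types p q : {poly K}.

(** Evaluation at [- b] shows that [p] vanishes there when [m] is positive; the quotient by
    ['X + b%:P] satisfies the same equation with [m - 1]. *)
Lemma euler_poly_exp (b : K) m p :
  (size p <= m.+1)%N -> ('X + b%:P) * p^`() = m%:R *: p ->
  exists c, p = c *: ('X + b%:P) ^+ m.
Proof.
elim: m p => [|m IHm] p sp Ep.
  by exists p`_0; rewrite expr0 alg_polyC; apply: size1_polyC.
have m0 : m.+1%:R != 0 :> K by rewrite Num.Theory.pnatr_eq0.
have : root p (- b).
  have /eqP := congr1 (horner^~ (- b)) Ep.
  by rewrite !hornerE /= addNr mul0r eq_sym mulf_eq0 (negPf m0).
rewrite root_factor_theorem polyCN opprK => /Pdiv.Field.dvdpP [q Eq].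
have sz0 : 'X + b%:P != 0 by rewrite -size_poly_eq0 size_XaddC.
have sq : (size q <= m.+1)%N.
  have [->|q0] := eqVneq q 0; first by rewrite size_poly0.
  by move: sp; rewrite Eq size_mul // size_XaddC addn2.
case: (IHm q sq) => [|c Ec].
  apply: (mulIf sz0); apply: (addIr (q * ('X + b%:P))).
  move: Ep; rewrite Eq derivM !derivE addr0 mulr1 mulrSr scalerDl scale1r.
  by rewrite -scalerAl => <-; ring.
by exists c; rewrite Eq Ec -scalerAl -exprSr.
Qed.

(* The summand of largest size cannot be cancelled. *)
Lemma sum_distinct_size_eq0 (I : finType) (F : I -> {poly K}) :
  (forall i j, F i != 0 -> F j != 0 -> size (F i) = size (F j) -> i = j) ->
  \sum_i F i = 0 -> forall i, F i = 0.
Proof.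
move=> Finj sF0 i0; apply/eqP/negPn/negP => F0.
case: (@arg_maxnP _ i0 (fun i => F i != 0) (fun i => size (F i)) F0) => i Fi maxi.
have /negP[] := Fi; rewrite -lead_coef_eq0 lead_coefE.
have := congr1 (fun p => p`_(size (F i)).-1) sF0.
rewrite coef_sum coef0 (bigD1 i) //= big1 ?addr0 => [-> //|j ji].
have [->|Fj] := eqVneq (F j) 0; first by rewrite coef0.
apply: nth_default; have := maxi j Fj; rewrite /geq /= leq_eqVlt => /orP[/eqP e|].
  by case/eqP: ji; apply: Finj.
by move=> lt; rewrite -ltnS (ltn_predK lt).
Qed.

End PolyFacts.

(** * The model C[x] and degrees in x *)

Section Unroll.
Set Implicit Arguments.
Unset Strict Implicit.
Variables (K : numFieldType) (n : nat) (n_gt0 : (0 < n)%N).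
Implicit Types f g : 'cV[{poly K}]_n.

(* Identifies C[d]^n with C[x], where d = x^n and the i-th basis vector is x^i;
   the matrix Cmat becomes multiplication by x. *)
Definition unroll f : {poly K} := \sum_(i < n) (f i 0 \Po 'X^n) * 'X^i.

Lemma coef_unroll f (q : nat) (r : 'I_n) : (unroll f)`_(q * n + r) = (f r 0)`_q.
Proof.
rewrite /unroll coef_sum (bigD1 r) //= big1 ?addr0 => [|i ir].
  rewrite coefMXn ltnNge leq_addl /= addnK coef_comp_poly_Xn //.
  by rewrite dvdn_mull // mulnK.
rewrite coefMXn; case: ltnP => // le_i; rewrite coef_comp_poly_Xn //.
case: ifP => // /dvdnP [k Ek]; case/eqP: ir; apply: val_inj => /=.
have /(congr1 (modn^~ n)) : (q * n + r = k * n + i)%N by lia.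
by rewrite !modnMDl !modn_small.
Qed.

Lemma unrollD f g : unroll (f + g) = unroll f + unroll g.
Proof.
rewrite /unroll -big_split; apply: eq_bigr => i _.
by rewrite mxE comp_polyD mulrDl.
Qed.

Lemma unrollZ p f : unroll (p *: f) = (p \Po 'X^n) * unroll f.
Proof.
rewrite /unroll mulr_sumr; apply: eq_bigr => i _.
by rewrite mxE comp_polyM mulrA.
Qed.

Lemma unroll0 : unroll 0 = 0.
Proof. by rewrite -(scale0r (0 : 'cV_n)) unrollZ comp_poly0 mul0r. Qed.

Lemma unroll_sum I r (P : pred I) (F : I -> 'cV[{poly K}]_n) :
  unroll (\sum_(i <- r | P i) F i) = \sum_(i <- r | P i) unroll (F i).
Proof. exact: (big_morph _ unrollD unroll0). Qed.

Lemma unroll_eq0 f : (unroll f == 0) = (f == 0).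
Proof.
apply/eqP/eqP => [f0|->]; last exact: unroll0.
apply/matrixP => i j; rewrite ord1 mxE; apply/polyP => k.
by rewrite -coef_unroll f0 !coef0.
Qed.

(** Each basis vector x^j goes to x^(j+1); the last one goes to d times the first, which is x *
    x^(n-1). *)
Lemma unroll_Cmat f : unroll (Cmat K n *m f) = 'X * unroll f.
Proof.
rewrite /unroll mulr_sumr.
transitivity (\sum_(i < n) \sum_(j < n)
    (Cmat K n i j \Po 'X^n) * (f j 0 \Po 'X^n) * 'X^i).
  apply: eq_bigr => i _; rewrite mxE raddf_sum mulr_suml.
  by apply: eq_bigr => j _; rewrite /= comp_polyM.
rewrite exchange_big; apply: eq_bigr => j _ /=.
have [jn|jn] := eqVneq j.+1 n.
  rewrite (bigD1 (Ordinal n_gt0)) //= big1 ?addr0 => [|i i0].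
    by rewrite mxE /= jn eqxx comp_polyX expr0 mulr1 -[X in 'X^X]jn exprS; ring.
  rewrite mxE jn eqxx andbT ifF; last by apply: contraNF i0 => /eqP i0; apply/eqP/val_inj.
  by rewrite ltn_eqF // raddf0 !mul0r.
have jn' : (j.+1 < n)%N by rewrite ltn_neqAle jn ltn_ord.
rewrite (bigD1 (Ordinal jn')) //= big1 ?addr0 => [|i ij].
  by rewrite mxE /= eqxx rmorph1 exprS; ring.
rewrite mxE (negPf jn) andbF (_ : (i == j.+1 :> nat) = false) ?raddf0 ?mul0r //.
by apply: contraNF ij => /eqP ij; apply/eqP/val_inj.
Qed.

(** Differentiation in d sends x^(q n + r) to a multiple of x^((q-1) n + r). *)
Lemma size_unroll_deriv f : (size (unroll (map_mx (@deriv K) f)) <= size (unroll f))%N.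
Proof.
apply/leq_sizeP => k lek.
pose r := Ordinal (ltn_pmod k n_gt0).
rewrite [k](divn_eq k n) (coef_unroll _ _ r) mxE coef_deriv -coef_unroll nth_default ?mul0rn //.
by rewrite mulSn -addnA -divn_eq (leq_trans lek) // leq_addl.
Qed.

Lemma size_unroll_calL f :
  f != 0 -> size (unroll (calL (Cmat K n) f)) = (size (unroll f)).+1.
Proof.
rewrite -unroll_eq0 => f0; rewrite unrollD unroll_Cmat addrC size_polyDl mulrC size_mulX //.
by rewrite ltnS size_unroll_deriv.
Qed.

Lemma size_unroll_iter_calL k f : f != 0 ->
  size (unroll (iter k (calL (Cmat K n)) f)) = (k + size (unroll f))%N.
Proof.
move=> f0; elim: k => //= k IHk; rewrite size_unroll_calL ?IHk //.
by rewrite -unroll_eq0 -size_poly_gt0 IHk addn_gt0 size_poly_gt0 unroll_eq0 f0 orbT.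
Qed.

(** The summand s D^k raises the degree by n + k; the other one vanishes for k = 0 and otherwise
    raises it by at most k - 1, so the leading term survives. *)
Lemma size_unroll_act a b k f : f != 0 ->
  size (unroll (Vabc_act a b (Cmat K n) f k)) = (n + k + size (unroll f))%N.
Proof.
move=> f0; rewrite Vabc_actE unrollZ comp_polyC mul_polyC size_scale; last first.
  by rewrite invr_eq0 Num.Theory.pnatr_eq0 -lt0n fact_gt0.
have sX : size ('X^n + b%:P : {poly K}) = n.+1.
  by rewrite size_polyDl size_polyXn // ltnS (leq_trans (size_polyC_leq1 _)).
rewrite unrollD !unrollZ comp_polyD comp_polyX !comp_polyC.
have E : size (('X^n + b%:P) * unroll (iter k (calL (Cmat K n)) f)) =
    (n + k + size (unroll f))%N.
  rewrite size_mul -?size_poly_eq0 ?sX ?size_unroll_iter_calL //; first by rewrite addnA.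
  by rewrite addn_eq0 size_poly_eq0 unroll_eq0 (negPf f0) andbF.
rewrite size_polyDl E // mul_polyC.
case: k {E} => [|k]; first by rewrite mul0r scale0r size_poly0 !addn_gt0 n_gt0.
rewrite (leq_ltn_trans (size_scale_leq _ _)) // size_unroll_iter_calL //.
by rewrite /=; lia.
Qed.

(** Hence nonzero scalars from C[d] preserve the degree in x modulo n. *)
Lemma size_unrollZ p f : p != 0 -> f != 0 ->
  size (unroll (p *: f)) = ((size p).-1 * n + size (unroll f))%N.
Proof.
move=> p0 f0; rewrite unrollZ.
have c0 : p \Po 'X^n != 0.
  apply: contraNneq p0 => c0; apply/eqP/polyP => i.
  have := coef_comp_poly_Xn p (i * n) n_gt0.
  by rewrite c0 dvdn_mull // mulnK // => <-; rewrite !coef0.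
rewrite size_mul ?unroll_eq0 //.
have := size_comp_poly p 'X^n; rewrite size_polyXn /= => <-.
by rewrite -size_poly_gt0 in c0; case: (size _) c0.
Qed.

End Unroll.

(** * The ideal I attached to a submodule *)

Section Submodule.
Set Implicit Arguments.
Unset Strict Implicit.
Variables (K : numFieldType) (n : nat) (a b : K) (C : 'M[{poly K}]_n).
Variable W : set (Vabc a b C).
Hypothesis subW : vir_submodule W.
Implicit Types (p q : {poly K}) (f v : 'cV[{poly K}]_n).
Notation s := ('X + b%:P : {poly K}).

Let annihilates p := forall v, W (p *: v).

Lemma submoduleD f v : W f -> W v -> W (f + v).
Proof. by case: subW => _ WD _ Wf Wv; rewrite -[f]scale1r; apply: WD. Qed.

Lemma submoduleZ p f : W f -> W (p *: f).
Proof. by case: subW => W0 WD _ Wf; rewrite -[_ *: f]addr0; apply: WD. Qed.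

Lemma submoduleB f v : W f -> W v -> W (f - v).
Proof. by move=> Wf Wv; rewrite -scaleN1r; apply: submoduleD => //; apply: submoduleZ. Qed.

Lemma submodule_act k f : W f ->
  W (s *: iter k (calL C) f + (k%:R * a)%:P *: iter k.-1 (calL C) f).
Proof.
case: subW => _ _ WA /(WA _ k) /= /(submoduleZ (k`!%:R)%:P).
rewrite Vabc_actE scalerA -polyCM mulfV ?polyC1 ?scale1r //.
by rewrite Num.Theory.pnatr_eq0 -lt0n fact_gt0.
Qed.

Lemma calL_scale p f : calL C (p *: f) = p^`() *: f + p *: calL C f.
Proof.
rewrite /calL -scalemxAr; apply/matrixP => i j.
by rewrite !mxE derivM; ring.
Qed.

Lemma annihilates_deriv p : annihilates p -> annihilates (s * p^`()).
Proof.
(* The subtracted vector is [p] times A_1 v. *)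
move=> Ip v; have := submoduleB (submodule_act 1 (Ip v)) (Ip (s *: calL C v + a%:P *: v)).
rewrite /= calL_scale mul1r; congr W.
by apply/matrixP => i j; rewrite !mxE; ring.
Qed.

(* Modulo s V only the term where all j derivatives hit s ^+ j survives. *)
Lemma iter_calL_exp j v : exists u,
  iter j (calL C) (s ^+ j *: v) = (j`!%:R)%:P *: v + s *: u.
Proof.
elim: j v => [|j IHj] v.
  by exists 0; rewrite /= expr0 fact0 scaler0 addr0.
rewrite iterSr calL_scale deriv_exp !derivE addr0 mul1r /=.
(* The second use is at a multiple of s, so all it yields is a multiple of s. *)
have [u Eu] := IHj v; have [u' Eu'] := IHj (s *: calL C v).
have -> : (s ^+ j *+ j.+1) *: v + s ^+ j.+1 *: calL C v =
    (j.+1%:R)%:P *: (s ^+ j *: v) + s ^+ j *: (s *: calL C v).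
  by rewrite !scalerA -exprSr polyC_natr mulr_natl.
exists ((j.+1%:R)%:P *: u + (j`!%:R)%:P *: calL C v + u').
rewrite iter_calL_linear Eu Eu' factS natrM polyCM.
by apply/matrixP => i k; rewrite !mxE; ring.
Qed.

Lemma annihilates_exp m : a != 0 -> annihilates (s ^+ m.+1) -> annihilates (s ^+ m).
Proof.
move=> a0 Im v.
have [u Eu] := iter_calL_exp m.+1 v.
(* The index m + 2 puts D^(m+1) in the second summand, just enough derivatives to remove s^(m+1);
   the factor s^m moves all other terms into s^(m+1) V. *)
have := submoduleZ (s ^+ m) (submodule_act m.+2 (Im v)).
rewrite [m.+2.-1]/= Eu.
set x := iter _ _ _; set c := m.+2%:R * a; set d := (m.+1)`!%:R.
move=> /submoduleB /(_ (Im (x + c%:P *: u))).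
have cd0 : c * d != 0.
  by rewrite !mulf_neq0 // Num.Theory.pnatr_eq0 -?lt0n ?fact_gt0.
move/(submoduleZ ((c * d)^-1)%:P); congr W.
have -> : s ^+ m *: (s *: x + c%:P *: (d%:P *: v + s *: u)) -
    s ^+ m.+1 *: (x + c%:P *: u) = (c * d)%:P *: (s ^+ m *: v).
  by rewrite exprS (polyCM c d); apply/matrixP => i j; rewrite !mxE; ring.
by rewrite scalerA -polyCM mulVf // scale1r.
Qed.

Lemma submodule_full p : a != 0 -> p != 0 -> annihilates p -> W = setT.
Proof.
move=> a0; have [m] := ubnP (size p); elim: m p => // m IHm p /ltnSE sp p0 Ip.
(* The leading terms cancel, so [q] is smaller than [p]: induction on the size replaces the choice
   of a least degree. *)
pose q := s * p^`() - (size p).-1%:R *: p.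
have Iq : annihilates q.
  move=> v; rewrite scalerBl; apply: submoduleB; first exact: annihilates_deriv.
  by rewrite -mul_polyC -scalerA; apply: submoduleZ.
have sq : (size q < size p)%N.
  rewrite -(prednK (n := size p)) ?size_poly_gt0 // ltnS.
  apply/leq_sizeP => j lej.
  rewrite coefB coefZ mulrDl coefD coefXM coefCM !coef_deriv.
  rewrite [p`_j.+1]nth_default; last exact: leq_trans (leqSpred _) _.
  rewrite mul0rn mulr0 addr0.
  case: j lej => [|j] /= lej; first by move: lej; rewrite leqn0 => /eqP->; rewrite mul0r subrr.
  rewrite mulr_natl; move: lej; rewrite leq_eqVlt => /orP[/eqP->|lej]; first by rewrite subrr.
  by rewrite nth_default ?mul0rn ?subrr // (leq_trans (leqSpred _)).
have [q0|q0] := eqVneq q 0; last first.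
  by apply: (IHm q) => //; apply: leq_trans sq sp.
have [k [c Ec]] : exists k c, p = c *: s ^+ k.
  exists (size p).-1; apply: euler_poly_exp; first exact: leqSpred.
  by apply/eqP; rewrite -subr_eq0 -/q q0.
have c0 : c != 0 by apply: contraNneq p0 => c0; rewrite Ec c0 scale0r.
have : annihilates (s ^+ k).
  move=> v; have := submoduleZ (c^-1)%:P (Ip v).
  by rewrite Ec scalerA mul_polyC scalerA mulVf // scale1r.
elim: k {Ec} => [I1|k IHk Ik]; last by apply/IHk/annihilates_exp.
by apply/seteqP; split=> // v _; have := I1 v; rewrite expr0 scale1r.
Qed.

End Submodule.

(** * Independence of the A_k f and irreducibility *)

Lemma Vabc_Cmat_irreducible (K : numFieldType) (n : nat) (a b : K) :
  (0 < n)%N -> a != 0 -> vir_irreducible (Vabc a b (Cmat K n)).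
Proof.
move=> n_gt0 a0; split.
  exists (const_mx 1) => /matrixP /(_ (Ordinal n_gt0) 0) /eqP.
  by rewrite !mxE oner_eq0.
move=> W subW; have [W0|] := pselect (W = [set 0]%classic); first by left.
move=> Wn0; right.
have [f [Wf f0]] : exists f : 'cV[{poly K}]_n, W f /\ f != 0.
  apply: contrapT => nf; apply: Wn0; apply/seteqP; split=> [f Wf|f ->]; last by case: subW.
  by apply/eqP; apply: contrapT => /negP f0; apply: nf; exists f.
pose w k := Vabc_act a b (Cmat K n) f k.
have Ww k : W (w k) by case: subW => _ _; apply.
have sw k : size (unroll (w k)) = (n + k + size (unroll f))%N.
  exact: size_unroll_act.
have w0 k : w k != 0.
  by rewrite -(unroll_eq0 n_gt0) -size_poly_gt0 sw !addn_gt0 n_gt0.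
pose A := \matrix_(i < n, k < n) w k i 0.
have mulA (u : 'cV_n) : A *m u = \sum_k u k 0 *: w k.
  apply/matrixP => i j; rewrite ord1 mxE summxE; apply: eq_bigr => k _.
  by rewrite !mxE mulrC.
apply: (submodule_full (p := \det A) subW a0).
  (* A zero determinant would give a nontrivial relation over C[d] among the [w k]. *)
  rewrite -det_tr; apply/negP => /det0P [u u0].
  move/(congr1 trmx); rewrite trmx_mul trmxK trmx0 mulA.
  move/(congr1 (@unroll K n)); rewrite unroll_sum unroll0.
  have nz p k : unroll (p *: w k) != 0 -> p != 0.
    by apply: contraNneq => ->; rewrite scale0r unroll0.
  move/sum_distinct_size_eq0 => uw; case/eqP: u0; apply/matrixP => i j.
  rewrite ord1 mxE; apply/eqP/negPn/negP => uj.
  have /eqP : unroll (u^T j 0 *: w j) = 0.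
    (* Equal sizes force k = l modulo n, and both are below n. *)
    apply: uw => k l /nz uk /nz ul; rewrite !size_unrollZ // !sw => e.
    apply: val_inj => /=; rewrite -(modn_small (ltn_ord k)) -(modn_small (ltn_ord l)).
    rewrite -(modnMDl (size (u^T k 0)).-1 k) -(modnMDl (size (u^T l 0)).-1 l).
    by congr (_ %% _)%N; move: e; rewrite !addnA !(addnAC _ n) => /addIn/addIn.
  by rewrite unroll_eq0 // scalemx_eq0 mxE (negPf uj) (negPf (w0 j)).
(* By the adjugate, [\det A *: v] is [A] applied to a vector, thus a combination of the [w k]. *)
move=> v; rewrite -mul_scalar_mx -mul_mx_adj -mulmxA mulA.
elim/big_ind: _ => [|x y|k _]; first by case: subW.
  exact: submoduleD.
by apply: submoduleZ.
Qed.

Theorem proposition4p26 (R : realType) (n : nat) (hn : (1 <= n)%N)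
    (a b : R[i]) (ha : a <> 0) :
  vir_irreducible (Vabc a b (Cmat R[i] n)).
Proof. exact/Vabc_Cmat_irreducible/eqP. Qed.
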